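(* Let $\lfloor n/e\rfloor=x_m\ell^m+\cdots+x_1\ell+x_0$ be the base-$\ell$ expansion, and let $$A=1+\sum_{i=0}^m x_i(\ell^i+\cdots+\ell+1),$$ $$Z=x_m(d\ell^m+\ell^{m-1}+\cdots+\ell+1)+x_{m-1}(d\ell^{m-1}+\ell^{m-2}+\cdots+\ell+1)+\cdots+x_1(d\ell+1)+x_0d+1,$$ $$C=x_m(\ell^{m-1}+\cdots+\ell+1)+x_{m-1}(\ell^{m-2}+\cdots+\ell+1)+\cdots+x_2(\ell+1)+x_1+1,$$ where $C=1$ if $m=0$. Then: (a) $V=C+X$, where $X$ is the number of distinct values $\phi(Q)$ ($Q\in\mathcal P$) satisfying $0\le\phi(Q)<d\lfloor n/e\rfloor$. Moreover, $X\ge\lfloor n/e\rfloor$, so $A\le V\le Z$. (b) Suppose $\lfloor n/e\rfloor\ge d\ell$. Then $V=Z-d^2\ell+Y$, where $Y$ is the number of distinct values $\phi(Q)$ ($Q\in\mathcal P$) satisfying $0\le\phi(Q)<d^2\ell$. Moreover, $Y\ge \ell d(d+1)/2$, so $Z-\ell d(d-1)/2\le V\le Z$. In fact, if $d\le\ell$ then $Y=\ell d(d+1)/2$, so $V=Z-\ell d(d-1)/2$, that is, $$V=x_m(d\ell^m+\ell^{m-1}+\cdots+\ell+1)+x_{m-1}(d\ell^{m-1}+\ell^{m-2}+\cdots+\ell+1)+\cdots+x_1(d\ell+1)+x_0d+1-\ell d(d-1)/2.$$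
   Context: Let $n\ge 2$, let $G=\mathrm{GL}_n(q)$ be the general linear group over the finite field $F_q$ of characteristic $p$, and let $\ell\ne p$ be a prime. $\nu_\ell$ denotes the $\ell$-adic valuation of integers. $B$ is the group of upper triangular matrices in $G$, and $\mathcal P$ is the set of standard parabolic subgroups (subgroups of $G$ containing $B$). A $\mathcal P$-value is an integer of the form $\nu_\ell([G:P])$ with $P\in\mathcal P$, and $V$ is the total number of distinct $\mathcal P$-values. For $P\in\mathcal P$ put $\phi(P)=\nu_\ell([P:B])$; since $[G:B]=[G:P][P:B]$, $V$ is also the number of distinct values of $\phi$ on $\mathcal P$. Let $e=\min\{i\ge 2 : \ell \mid \frac{q^i-1}{q-1}\}$, $d=\nu_\ell\big(\frac{q^e-1}{q-1}\big)$, and $m=\max\{i\ge 0 : \ell^i\le\lfloor n/e\rfloor\}$ (with $m=0$ and $x_0=0$ if $n<e$). *)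

(* Defs.v *)
From mathcomp Require Import all_boot all_order all_algebra all_fingroup.
From mathcomp Require Import cyclic.

Set Implicit Arguments.
Unset Strict Implicit.
Unset Printing Implicit Defensive.

Import GRing.Theory GroupScope.
Local Open Scope nat_scope.

Section Parabolics.

Variables (n : nat) (F : finFieldType).

(* [is_trig_mx] is lower triangularity in MathComp, whence the transpose. *)
Definition borel : {set {'GL_n[F]}} :=
  [set g : {'GL_n[F]} | is_trig_mx (GLval g)^T].

Lemma borel_group_set : group_set borel.
Proof.
apply/group_setP; split.
  by rewrite inE GL_1E -[(1 : 'M_n.-1.+1)%R]/(1%:M)%R tr_scalar_mx scalar_mx_is_trig.
move=> g h; rewrite !inE => /is_trig_mxP Hg /is_trig_mxP Hh.
apply/is_trig_mxP => i j ltij; rewrite GL_MxE !mxE big1 // => k _.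
case: (ltnP k j) => [ltkj | lejk].
  by have := Hg k j ltkj; rewrite mxE => ->; rewrite mul0r.
by have := Hh i k (leq_trans ltij lejk); rewrite mxE => ->; rewrite mulr0.
Qed.

Canonical borel_group := Group borel_group_set.

Definition std_parabolics : {set {group {'GL_n[F]}}} :=
  [set P : {group {'GL_n[F]}} | borel \subset P].

Definition num_Pvalues (l : nat) : nat :=
  size (undup [seq logn l #|'GL_n[F] : P| | P : {group {'GL_n[F]}} in std_parabolics]).

Definition phi (l : nat) (P : {group {'GL_n[F]}}) : nat := logn l #|P : borel|.

Definition num_phi_below (l b : nat) : nat :=
  size (undup [seq phi l Q | Q : {group {'GL_n[F]}} in
                 [set Q in std_parabolics | phi l Q < b]]).

End Parabolics.

(* The division is exact. *)
Definition qnum (q i : nat) : nat := (q ^ i - 1) %/ (q - 1).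

Definition is_min (P : pred nat) (k : nat) : Prop :=
  P k /\ forall i, P i -> k <= i.

Definition e_cond (l q : nat) : pred nat := fun i => (2 <= i) && (l %| qnum q i).

Lemma e_exists (l q : nat) :
  prime l -> 1 < q -> coprime q l -> exists e, is_min (e_cond l q) e.
Proof.
move=> l_pr q_gt1 co_ql.
have q1_gt0 : 0 < q - 1 by rewrite subn_gt0.
set N := l * (q - 1).
have N_gt0 : 0 < N by rewrite muln_gt0 prime_gt0.
have coqN : coprime q N.
  by rewrite coprimeMr co_ql /= subn1 coprimenP // ltnW.
suff: exists i, e_cond l q i.
  by move=> ex; case: (ex_minnP ex) => e He mine; exists e; split.
exists (totient N * 2); rewrite /e_cond leq_pmull ?totient_gt0 //=.
rewrite /qnum dvdn_divRL; last by rewrite !subn1 dvdn_pred_predX.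
rewrite -/N -eqn_mod_dvd ?expn_gt0 ?(ltnW q_gt1) // expnM.
by rewrite -modnXm (Euler_exp_totient coqN) modnXm exp1n.
Qed.

(* [\sum_(j < i) l ^ j] is l^(i-1) + ... + l + 1, and 0 for i = 0. *)
Definition sumA (l m : nat) (x : nat -> nat) : nat :=
  1 + \sum_(0 <= i < m.+1) x i * \sum_(j < i.+1) l ^ j.

Definition sumZ (l d m : nat) (x : nat -> nat) : nat :=
  \sum_(0 <= i < m.+1) x i * (d * l ^ i + \sum_(j < i) l ^ j) + 1.

Definition sumC (l m : nat) (x : nat -> nat) : nat :=
  \sum_(1 <= i < m.+1) x i * (\sum_(j < i) l ^ j) + 1.

(* Main.v *)
Require Import Defs.
From mathcomp Require Import all_boot all_order all_algebra all_fingroup.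
From mathcomp Require Import finfield.
From mathcomp Require Import zify ring.

(** An overgroup [P] of the Borel group is block triangular for a composition
[(n_1, ..., n_r)] of [n], and every composition occurs. Up to a power of [q],
prime to [l], the order of [P] is the product of the orders of the groups
GL_(n_i), so [phi P] is the sum of the valuations of the [q]-factorials of the
[n_i] ([phi_composition], [composition_phi]).

That [P] is block triangular is proved without the Bruhat decomposition
([overgroup_borelE]). If [P] does not preserve the span of the first [c] basis
vectors, conjugating suitable upper triangular transvections produces, inside
[P], a root subgroup strictly below that cut; commutation with upper root
subgroups moves it next to the diagonal. Hence [P] contains all the root
subgroups of its diagonal blocks, and Gaussian elimination shows that it
contains every block triangular matrix.

By minimality of [e] and lifting the exponent, the valuation of [qnum q i] is
[d + logn l (i %/ e)] if [e] divides [i] and 0 otherwise. Hence the [q]-factorial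
of [k] has valuation [d * (k %/ e) + vfact (k %/ e)], where [vfact j] is the
valuation of the factorial of [j]. With [N = n %/ e], the values of [phi] are
therefore the sums of [d * M_i + vfact M_i] over finite sequences with
[sum M_i <= N]. Fixing [s = sum M_i], the sum of the [vfact M_i] takes exactly
the values between 0 and [vfact s]: it is at most [vfact s] because multinomial
coefficients are integers, and [vfact_composition] attains each value. So the
values of [phi] form the union over [s <= N] of the intervals
[[d * s, d * s + vfact s]] ([phi_spread]), and everything reduces to counting in
this union.

The last interval, [s = N], is the set of values that are at least [d * N]; it
has [vfact N + 1 = C] elements, and the top of it is [Z - 1], by Legendre's
formula for [vfact N] in terms of the digits of [N]. This gives (a), the
elements [d * s] with [s < N] accounting for [N <= X]. For (b), the intervals
with [s >= d * l] overlap or touch, because [vfact s >= s %/ l >= d], so every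
integer from [d ^ 2 * l] to [Z - 1] is a value; and for [s < d * l] the window
between [d * s] and [d * s.+1] contains at least [s %/ l + 1] values, and exactly
that many when [d <= l], since then [s < l ^ 2] and [vfact s = s %/ l]. *)

Set Implicit Arguments.
Unset Strict Implicit.
Unset Printing Implicit Defensive.

Import GRing.Theory.
Local Open Scope nat_scope.

(** * Transvections *)

Section Transvections.
Variables (R : comUnitRingType) (N : nat).
Local Open Scope ring_scope.

Local Notation col_delta r := (delta_mx r 0 : 'cV[R]_N).
Local Notation row_delta s := (delta_mx 0 s : 'rV[R]_N).

(** The elements [x |-> x + f(x) v]; all uses have [f v = 0], which makes them
transvections. Keeping [v] and [f] arbitrary, instead of basis vectors, lets
conjugation act on the two factors separately. *)
Definition transv (v : 'cV[R]_N) (f : 'rV[R]_N) : 'M[R]_N := 1%:M + v *m f.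

Lemma transvMl v w f : (f *m w = 0) ->
  (transv v f *m transv w f = transv (v + w) f).
Proof.
move=> fw; rewrite /transv mulmxDl mul1mx mulmxDr mulmx1 mulmxDl.
by rewrite mulmxA -(mulmxA v) fw mulmx0 mul0mx addr0 -addrA (addrC (v *m f)).
Qed.

Lemma transvVl v f : (f *m v = 0) -> (transv v f *m transv (- v) f = 1%:M).
Proof. by move=> fv; rewrite transvMl ?subrr ?mulmxN ?fv ?oppr0 // /transv mul0mx addr0. Qed.

Lemma transv_unit v f : (f *m v = 0) -> transv v f \in unitmx.
Proof. by move/transvVl/mulmx1_unit => []. Qed.

Lemma transv_inv v f : (f *m v = 0) -> invmx (transv v f) = transv (- v) f.
Proof.
move=> fv; rewrite -[RHS](mulKmx (transv_unit fv)) transvVl //.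
by rewrite mulmx1.
Qed.

Lemma conj_transv M v f : M \in unitmx ->
  (M *m transv v f *m invmx M = transv (M *m v) (f *m invmx M)).
Proof.
by move=> uM; rewrite /transv mulmxDr mulmx1 mulmxDl mulmxV // !mulmxA.
Qed.

Lemma row_delta_mul (s : 'I_N) (v : 'cV[R]_N) : (row_delta s *m v = (v s 0)%:M).
Proof. by rewrite -rowE; apply/matrixP => i j; rewrite !mxE !ord1 eqxx mulr1n. Qed.

Lemma mul_col_delta (f : 'rV[R]_N) (s : 'I_N) : (f *m col_delta s = (f 0 s)%:M).
Proof. by rewrite -colE; apply/matrixP => i j; rewrite !mxE !ord1 eqxx mulr1n. Qed.

Lemma transvE v f i j : (transv v f i j = (i == j)%:R + v i 0 * f 0 j).
Proof. by rewrite !mxE big_ord1. Qed.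

Lemma transv_deltaM (v : 'cV[R]_N) (a i j : 'I_N) (M : 'M[R]_N) :
  (transv v (row_delta a) *m M) i j = M i j + v i 0 * M a j.
Proof.
by rewrite /transv mulmxDl mul1mx -mulmxA -rowE mxE mxE big_ord1 mxE.
Qed.

End Transvections.

(** * Standard parabolic subgroups as block triangular groups *)

Section Parabolic.
Variables (F : finFieldType).
Implicit Type S : pred nat.

(** A set of cuts [S] encodes a composition: a cut at [c] separates the indices
below [c] from the others, and only cuts [0 < c < k] have an effect on
matrices of size [k]. *)
Definition cut_between (S : pred nat) (j i : nat) : bool :=
  has S (index_iota j.+1 i.+1).

Lemma cut_betweenP (S : pred nat) j i :
  reflect (exists2 c, j < c <= i & S c) (cut_between S j i).
Proof.
apply: (iffP hasP) => [] [c cji Sc]; exists c => //.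
  by move: cji; rewrite mem_index_iota ltnS.
by rewrite mem_index_iota ltnS.
Qed.

Definition block_triangular (S : pred nat) k (M : 'M[F]_k) : bool :=
  [forall i : 'I_k, forall j : 'I_k, cut_between S j i ==> (M i j == 0)%R].

Lemma block_triangularP S k (M : 'M[F]_k) :
  reflect (forall (i j : 'I_k) c, j < c <= i -> S c -> M i j = 0%R)
          (block_triangular S M).
Proof.
apply: (iffP idP) => [/forallP H i j c cji Sc | H].
  have /forallP /(_ j) /implyP /(_ _) /eqP := H i.
  by apply; apply/cut_betweenP; exists c.
apply/forallP => i; apply/forallP => j; apply/implyP => /cut_betweenP[c cji Sc].
by apply/eqP; apply: H Sc.
Qed.

Lemma block_triangularM S k (M N : 'M[F]_k) :
  block_triangular S M -> block_triangular S N -> block_triangular S (M *m N)%R.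
Proof.
move=> /block_triangularP HM /block_triangularP HN.
apply/block_triangularP => i j c /andP[jc ci] Sc; rewrite mxE big1 // => t _.
case: (ltnP t c) => [tc | ct].
  by rewrite (HM i t c) ?mul0r // tc.
by rewrite (HN t j c) ?mulr0 // jc.
Qed.

Lemma block_triangular1 S k : block_triangular S (1%:M : 'M[F]_k)%R.
Proof.
apply/block_triangularP => i j c /andP[jc ci] _; rewrite mxE.
by case: eqP => // ij; move: (leq_trans jc ci); rewrite ij ltnn.
Qed.

Variable n : nat.
Local Notation N := n.-1.+1.

Definition parabolic (S : pred nat) : {set {'GL_n[F]}} :=
  [set g : {'GL_n[F]} | block_triangular S (GLval g)].

Lemma parabolicE S g : (g \in parabolic S) = block_triangular S (GLval g).
Proof. by rewrite inE. Qed.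

Lemma parabolic_group_set S : group_set (parabolic S).
Proof.
apply/group_setP; split; first by rewrite inE; apply: block_triangular1.
by move=> g h; rewrite !inE GL_MxE; apply: block_triangularM.
Qed.

Canonical parabolic_group S := Group (parabolic_group_set S).

Lemma borel_parabolic : borel n F = parabolic predT.
Proof.
apply/setP => g; rewrite !inE; apply/is_trig_mxP/block_triangularP.
  by move=> H i j c /andP[jc ci] _; move: (H j i (leq_trans jc ci)); rewrite mxE.
by move=> H i j ij; rewrite mxE; apply: (H j i j); rewrite ?ij ?leqnn.
Qed.

Lemma borel_sub_parabolic S : borel n F \subset parabolic S.
Proof.
rewrite borel_parabolic; apply/subsetP => g; rewrite !inE.
move=> /block_triangularP H; apply/block_triangularP => i j c cji _.
exact: (H i j c).
Qed.

Lemma GL_memM (P : {group {'GL_n[F]}}) (g h : {'GL_n[F]}) :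
  g \in P -> h \in P -> (g * h)%g \in P.
Proof. exact: (@groupM _ P g h). Qed.

Lemma GL_memV (P : {group {'GL_n[F]}}) (g : {'GL_n[F]}) : g \in P -> (g^-1)%g \in P.
Proof. exact: (@groupVr _ P g). Qed.

(** Matrices that obey a triangular pattern are closed under products, hence
form a group by finiteness, so the pattern passes to inverses. *)
Lemma GL_inv_stable c (g : {'GL_n[F]}) :
  (forall i j : 'I_N, j < c <= i -> GLval g i j = 0%R) ->
  forall i j : 'I_N, j < c <= i -> GLval (g^-1)%g i j = 0%R.
Proof.
move=> H i j cji.
have gP: g \in parabolic_group (pred1 c).
  by rewrite parabolicE; apply/block_triangularP => i' j' c' h /eqP ec; apply: H; rewrite -ec.
have := GL_memV gP; rewrite parabolicE => /block_triangularP/(_ i j c cji).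
by apply; apply: eqxx.
Qed.

(** Otherwise [M] would map the span of the first [a] basis vectors to itself
and send the next one into it as well; inverting [M] gives a contradiction. *)
Lemma pivot_exists (M : 'M[F]_N) (a : 'I_N) : M \in unitmx ->
  (forall i j : 'I_N, j < i -> j < a -> M i j = 0%R) ->
  exists2 i : 'I_N, a <= i & M i a != 0%R.
Proof.
move=> uM H; case: (boolP [exists i : 'I_N, (a <= i) && (M i a != 0%R)]).
  by case/existsP => i /andP[]; exists i.
rewrite negb_exists => /forallP noi; pose g : {'GL_n[F]} := Sub M uM.
have gM : GLval g = M by [].
have Hinv : forall i j : 'I_N, j < a <= i -> invmx M i j = 0%R.
  move=> i j jai; rewrite -gM -GL_VxE; apply: (@GL_inv_stable a) => //.
  move=> k l /andP[la ak]; rewrite gM; apply: H => //.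
  exact: leq_trans la ak.
have /matrixP/(_ a a)/eqP := mulVmx uM.
rewrite !mxE eqxx big1 ?(eq_sym 0%R) ?oner_eq0 // => k _.
case: (ltnP k a) => [ka|ak]; first by rewrite Hinv ?mul0r // ka leqnn.
by move: (noi k); rewrite ak negbK => /eqP->; rewrite mulr0.
Qed.

Section Overgroup.
Local Open Scope ring_scope.
Variable P : {group {'GL_n[F]}}.
Hypothesis borelP : borel n F \subset P.

(** Membership in [P] for a matrix whose invertibility is not known beforehand. *)
Definition has_matrix (M : 'M[F]_N) := exists2 g : {'GL_n[F]}, g \in P & GLval g = M.

Local Notation Q := has_matrix.
Local Notation col_delta r := (delta_mx r 0 : 'cV[F]_N).
Local Notation row_delta s := (delta_mx 0 s : 'rV[F]_N).

Lemma has_matrixM M M' : Q M -> Q M' -> Q (M *m M').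
Proof. by move=> [g Pg <-] [h Ph <-]; exists (g * h)%g; [exact: GL_memM | exact: GL_MxE]. Qed.

Lemma has_matrix_unit M : Q M -> M \in unitmx.
Proof. by move=> [g _ <-]; exact: GL_unitmx. Qed.

Lemma has_matrixV M : Q M -> Q (invmx M).
Proof. by move=> [g Pg <-]; exists (g^-1)%g; [exact: GL_memV | exact: GL_VxE]. Qed.

Lemma has_matrixVr M M' : Q M -> Q (M *m M') -> Q M'.
Proof.
move=> QM /(has_matrixM (has_matrixV QM)).
by rewrite mulKmx // has_matrix_unit.
Qed.

Lemma has_matrix_upper M :
  M \in unitmx -> (forall i j : 'I_N, (j < i)%N -> M i j = 0) -> Q M.
Proof.
move=> uM H; pose g : {'GL_n[F]} := Sub M uM.
exists g => //; apply: (subsetP borelP); rewrite inE.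
by apply/is_trig_mxP => i j ij; rewrite mxE; apply: H.
Qed.

Lemma has_matrix1 : Q 1%:M.
Proof.
apply: has_matrix_upper; first exact: unitmx1.
by move=> k l lk; rewrite mxE; case: eqP lk => [->|]; rewrite ?ltnn.
Qed.

Lemma has_matrix_conj M v f :
  Q M -> Q (transv v f) -> Q (transv (M *m v) (f *m invmx M)).
Proof.
move=> QM Qv; rewrite -conj_transv ?has_matrix_unit //.
exact: has_matrixM (has_matrixM QM Qv) (has_matrixV QM).
Qed.

(** [P] contains the root subgroup of the pair [(i, j)]. *)
Definition root_in (i j : 'I_N) := forall t : F, Q (transv (t *: col_delta i) (row_delta j)).

Lemma root_upper (i j : 'I_N) : (i < j)%N -> root_in i j.
Proof.
move=> ij t; apply: has_matrix_upper.
  apply: transv_unit; rewrite row_delta_mul !mxE.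
  by case: eqP ij => [-> | _]; rewrite ?ltnn // mulr0 raddf0.
move=> k l lk; rewrite transvE !mxE.
case: eqP lk => [-> | _ lk]; first by rewrite ltnn.
rewrite add0r eqxx andbT.
case: (k =P i) => [ki | _]; last by rewrite !(mulr0, mul0r).
case: eqP => [lj | _]; last by rewrite mulr0.
by move: lk; rewrite ki lj ltnNge ltnW.
Qed.

(** Conjugating [1 + t e_j e_k^*] by [1 + e_i e_j^*] adds the term
[t e_i e_k^*]. *)
Lemma root_trans (i j k : 'I_N) : i != j -> j != k -> i != k ->
  root_in i j -> root_in j k -> root_in i k.
Proof.
move=> ij jk ik Rij Rjk t.
have zij : (row_delta j *m (1 *: col_delta i) = 0).
  by rewrite row_delta_mul !mxE (eq_sym j) (negbTE ij) mulr0 raddf0.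
have zkj : (row_delta k *m (t *: col_delta j) = 0).
  by rewrite row_delta_mul !mxE (eq_sym k) (negbTE jk) mulr0 raddf0.
have := has_matrix_conj (Rij 1) (Rjk t).
rewrite transv_inv // /transv mulmxDl mul1mx mulmxDr mulmx1.
have ->: (row_delta k *m (- (1 *: col_delta i) *m row_delta j) = 0).
  rewrite mulmxA row_delta_mul !mxE (eq_sym k) (negbTE ik).
  by rewrite mulr0 oppr0 raddf0 mul0mx.
rewrite addr0 -mulmxA row_delta_mul mul_mx_scalar scalerA !mxE !eqxx !mulr1.
move=> H; apply: (has_matrixVr (Rjk t)).
by rewrite transvMl // row_delta_mul !mxE (eq_sym k) (negbTE ik) mulr0 raddf0.
Qed.

(** If [g] moves the span [V_c] of the first [c] basis vectors, then so does
[g^-1]. Hence some [g e_j] with [j < c] leaves [V_c], and some coordinate form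
[e_b^*] with [c <= b] is nonzero on [g^-1 V_c]. Conjugating by [g] the upper
triangular [1 + t e_j e_b^*] gives the transvections wanted. *)
Lemma exists_lower_transv (g : {'GL_n[F]}) (i j : 'I_N) c :
  g \in P -> (j < c <= i)%N -> GLval g i j != 0 ->
  exists v f, [/\ forall t : F, Q (transv (t *: v) f), (f *m v = 0),
     exists2 r : 'I_N, (c <= r)%N & v r 0 != 0 &
     exists2 s : 'I_N, (s < c)%N & f 0 s != 0].
Proof.
move=> Pg /andP[jc ci] gij.
have [b [s [cb sc gbs]]] :
    exists b s : 'I_N, [/\ (c <= b)%N, (s < c)%N & GLval (g^-1)%g b s != 0].
  case: (boolP [exists b : 'I_N, exists s : 'I_N,
                 [&& (c <= b)%N, (s < c)%N & GLval (g^-1)%g b s != 0]]).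
    by move=> /existsP[b /existsP[s /and3P[]]]; exists b, s.
  rewrite negb_exists => /forallP H; case/eqP: gij.
  rewrite -(invgK g); apply: (@GL_inv_stable c) => [b s /andP[sc cb]|]; last first.
    by rewrite jc.
  move: (H b); rewrite negb_exists => /forallP/(_ s).
  by rewrite cb sc /= negbK => /eqP.
exists (GLval g *m col_delta j), (row_delta b *m GLval (g^-1)%g); split.
- move=> t; rewrite scalemxAr GL_VxE.
  apply: has_matrix_conj; first by exists g.
  by apply: root_upper; apply: leq_trans jc cb.
- rewrite mulmxA -(mulmxA _ _ (GLval g)) GL_VxE mulVmx ?GL_unitmx // mulmx1 row_delta_mul mxE.
  by case: eqP (leq_trans jc cb) => [->|_ _]; rewrite ?ltnn ?raddf0.
- by exists i; rewrite // -colE mxE.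
by exists s; rewrite // -rowE mxE.
Qed.

(** Upper triangular conjugations, which preserve both nonvanishing conditions,
reduce [v] and then [f] to multiples of a basis vector and of a coordinate
form. *)
Lemma exists_lower_root (v : 'cV[F]_N) (f : 'rV[F]_N) c :
  (forall t : F, Q (transv (t *: v) f)) -> (f *m v = 0) ->
  (exists2 r : 'I_N, (c <= r)%N & v r 0 != 0) ->
  (exists2 s : 'I_N, (s < c)%N & f 0 s != 0) ->
  exists r s : 'I_N, [/\ (c <= r)%N, (s < c)%N & root_in r s].
Proof.
move=> Qvf fv0 [r0 cr0 vr0] [s0 sc0 fs0].
have [r vr rmax'] := @arg_maxnP _ r0 (fun r : 'I_N => v r 0 != 0) val vr0.
have rmax (k : 'I_N) : v k 0 != 0 -> (k <= r)%N by apply: rmax'.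
have cr : (c <= r)%N by apply: leq_trans cr0 (rmax _ vr0).
(* 1 + w e_r^* maps v to (v r) e_r; it is upper triangular by maximality of r *)
pose w : 'cV[F]_N := ((v r 0)^-1 *: (v r 0 *: col_delta r - v)).
have wr : (row_delta r *m w = 0).
  by rewrite row_delta_mul !mxE !eqxx mulr1 subrr mulr0 raddf0.
have uw := transv_unit wr.
have Qw : Q (transv w (row_delta r)).
  apply: has_matrix_upper => // k l lk; rewrite transvE !mxE eqxx.
  case: eqP lk => [->|_ lk]; rewrite ?ltnn // add0r.
  case: (l =P r) => [lr|_]; last by rewrite mulr0.
  have: ~~ (v k 0 != 0) by apply/negP => /rmax; rewrite leqNgt -lr lk.
  rewrite negbK => /eqP ->; case: (k =P r) => [kr|_].
    by move: lk; rewrite kr lr ltnn.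
  by rewrite mulr0 subr0 mulr0 mul0r.
pose f1 := (f *m invmx (transv w (row_delta r))).
have v1 : (transv w (row_delta r) *m v = v r 0 *: col_delta r).
  rewrite /transv mulmxDl mul1mx -mulmxA row_delta_mul mul_mx_scalar.
  by rewrite scalerA mulfV // scale1r addrC subrK.
have Q1 t : Q (transv (t *: col_delta r) f1).
  have := has_matrix_conj Qw (Qvf (t / v r 0)).
  by rewrite -scalemxAr v1 scalerA mulfVK.
have f1r : (f1 0 r = 0).
  have: (f1 *m (v r 0 *: col_delta r) = 0) by rewrite -v1 mulmxA mulmxKV.
  rewrite -scalemxAr mul_col_delta => /matrixP/(_ 0 0)/eqP.
  by rewrite !mxE eqxx mulr1n mulf_eq0 (negbTE vr) => /eqP.
have f1s0 : f1 0 s0 != 0.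
  rewrite /f1 transv_inv // /transv mulmxDr mulmx1 mulmxA mxE.
  rewrite [X in (_ + X)](_ : _ = 0) ?addr0 //.
  rewrite !mxE big_ord1 !mxE.
  case: (s0 =P r) => [sr|_]; last by rewrite andbF mulr0.
  by move: sc0; rewrite sr ltnNge cr.
clearbody f1.
(* f1 (1 + e_s h) = (f1 s) e_s^*, while f1 r = 0 makes 1 + e_s h fix e_r *)
have [s fs smin'] := @arg_minnP _ s0 (fun s : 'I_N => f1 0 s != 0) val f1s0.
have smin (k : 'I_N) : f1 0 k != 0 -> (s <= k)%N by apply: smin'.
have sc : (s < c)%N by apply: leq_ltn_trans (smin _ f1s0) sc0.
have rs : r != s by apply: contraTneq sc => <-; rewrite -leqNgt.
pose h : 'rV[F]_N := ((f1 0 s)^-1 *: (f1 - f1 0 s *: row_delta s)).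
have hs : (h *m col_delta s = 0).
  by rewrite mul_col_delta !mxE !eqxx mulr1 subrr mulr0 raddf0.
have Qh : Q (transv (col_delta s) h).
  apply: has_matrix_upper => [|k l lk]; first exact: transv_unit.
  rewrite transvE !mxE eqxx andbT.
  case: eqP lk => [->|_ lk]; rewrite ?ltnn // add0r.
  case: (k =P s) => [ks|_]; last by rewrite mul0r.
  have: ~~ (f1 0 l != 0) by apply/negP => /smin; rewrite leqNgt -ks lk.
  rewrite negbK => /eqP ->; case: (l =P s) => [ls|_].
    by move: lk; rewrite ks ls ltnn.
  by rewrite mulr0 subr0 mulr0 mulr0.
exists r, s; split=> // t.
have := has_matrix_conj Qh (Q1 (t / f1 0 s)).
rewrite transv_inv //.
have ->: (transv (col_delta s) h *m ((t / f1 0 s) *: col_delta r)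
          = (t / f1 0 s) *: col_delta r).
  rewrite /transv mulmxDl mul1mx -mulmxA -scalemxAr mul_col_delta.
  rewrite !mxE f1r (negbTE rs) andbF mulr0 subr0 mulr0 raddf0 scaler0.
  by rewrite mulmx0 addr0.
have ->: (f1 *m transv (- col_delta s) h = f1 0 s *: row_delta s).
  rewrite /transv mulmxDr mulmx1 mulmxA mulmxN mul_col_delta mulNmx.
  rewrite mul_scalar_mx scalerA mulfV // scale1r opprB.
  by rewrite addrC subrK.
by rewrite /transv -scalemxAl -scalemxAr scalerA mulfVK // scalemxAl.
Qed.

Lemma root_shrink (i j r s : 'I_N) : (s <= j)%N -> (j < i)%N -> (i <= r)%N ->
  root_in r s -> root_in i j.
Proof.
move=> sj ji ir Rrs.
have neqI (k l : 'I_N) : (k < l)%N -> k != l by move=> kl; rewrite -val_eqE ltn_eqF.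
have Ris : root_in i s.
  move: ir; rewrite leq_eqVlt => /orP[/eqP/val_inj -> //|ir].
  apply: (@root_trans i r s) => //; first exact: neqI.
  - by rewrite eq_sym neqI // (leq_ltn_trans sj) // (ltn_trans ji).
  - by rewrite eq_sym neqI // (leq_ltn_trans sj).
  exact: root_upper.
move: sj; rewrite leq_eqVlt => /orP[/eqP/val_inj <- //|sj].
apply: (@root_trans i s j) => //; last exact: root_upper.
- by rewrite eq_sym neqI // (ltn_trans sj).
- exact: neqI.
by rewrite eq_sym neqI.
Qed.

(** The cuts [c] such that [P] preserves the span of the first [c] basis vectors. *)
Definition stable_cut : pred nat := fun c => P \subset parabolic (pred1 c).

Lemma sub_parabolic_stable_cut : P \subset parabolic stable_cut.
Proof.
apply/subsetP => g Pg; rewrite parabolicE.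
apply/block_triangularP => i j c cji Sc.
have := subsetP Sc g Pg; rewrite parabolicE => /block_triangularP H.
by apply: (H i j c cji); apply: eqxx.
Qed.

Lemma root_unstable_cut c : ~~ stable_cut c ->
  exists r s : 'I_N, [/\ (c <= r)%N, (s < c)%N & root_in r s].
Proof.
case/subsetPn => g Pg; rewrite parabolicE negb_forall => /existsP[i].
rewrite negb_forall => /existsP[j]; rewrite negb_imply.
case/andP => /cut_betweenP[c' cji Ec'] gij.
move: cji; have -> : c' = c by apply/eqP.
move=> cji.
have [v [f [Qvf fv vr fs]]] := exists_lower_transv Pg cji gij.
exact: exists_lower_root Qvf fv vr fs.
Qed.

(** An unstable cut at [i] gives a root subgroup below the diagonal at row
[i] and column [i - 1]; those for consecutive cuts compose. *)
Lemma root_lower (i j : 'I_N) : (j < i)%N -> ~~ cut_between stable_cut j i ->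
  root_in i j.
Proof.
move: {2}(i - j)%N (leqnn (i - j)) => m.
elim: m i => [|m IHm] i; first by rewrite leqn0 subn_eq0 leqNgt => /negbTE->.
move=> ijm ji nocut.
have [r [s [ir si Rrs]]] : exists r s : 'I_N, [/\ (i <= r)%N, (s < i)%N & root_in r s].
  apply: root_unstable_cut; apply: contra nocut => Si.
  by apply/cut_betweenP; exists (val i); rewrite // ji leqnn.
have i0 : (0 < i)%N by apply: leq_ltn_trans ji.
have iN : (i.-1 < N)%N by apply: leq_ltn_trans (leq_pred _) (ltn_ord i).
pose k : 'I_N := Ordinal iN.
have kE : k.+1 = i :> nat by rewrite /= prednK.
have ki : (k < i)%N by rewrite -kE.
have Rik : root_in i k by apply: root_shrink ki ir Rrs; rewrite -ltnS kE.
have: (j <= k)%N by rewrite -ltnS kE.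
rewrite leq_eqVlt => /orP[/eqP/val_inj -> //|jk].
apply: (@root_trans i k j) => //.
- by rewrite eq_sym -val_eqE ltn_eqF.
- by rewrite eq_sym -val_eqE ltn_eqF.
- by rewrite eq_sym -val_eqE ltn_eqF.
apply: IHm => //.
  by move: ijm; rewrite !leq_subLR addnS -kE ltnS.
apply: contra nocut => /cut_betweenP[c /andP[jc ck] Sc].
by apply/cut_betweenP; exists c; rewrite // jc (leq_trans ck) // ltnW.
Qed.

Lemma has_matrix_transv_sum (v : 'cV[F]_N) (a : 'I_N) : v a 0 = 0 ->
  (forall i, v i 0 != 0 -> root_in i a) -> Q (transv v (row_delta a)).
Proof.
move=> va0 H; pose K (w : 'cV[F]_N) := w a 0 = 0 /\ Q (transv w (row_delta a)).
suff: K v by case.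
have ->: v = \sum_i v i 0 *: col_delta i.
  apply/colP => i; rewrite summxE (bigD1 i) //= !mxE !eqxx mulr1 big1 ?addr0 //.
  by move=> k ki; rewrite !mxE eq_sym (negbTE ki) mulr0.
apply: (big_ind K) => [|v1 v2 [z1 Q1] [z2 Q2]|i _].
- by split; [rewrite mxE | rewrite /transv mul0mx addr0; apply: has_matrix1].
- split; first by rewrite mxE z1 z2 addr0.
  rewrite -transvMl; first exact: has_matrixM.
  by rewrite row_delta_mul z2 raddf0.
case: (eqVneq (v i 0) 0) => [->|vi].
  by rewrite scale0r; split; [rewrite mxE | rewrite /transv mul0mx addr0; apply: has_matrix1].
split; last exact: H.
rewrite !mxE; case: (a =P i) => [ai|]; last by rewrite mulr0.
by rewrite -ai va0 eqxx in vi.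
Qed.

Lemma has_matrix_block_triangular M : Q M -> block_triangular stable_cut M.
Proof.
by move=> [g Pg <-]; have := subsetP sub_parabolic_stable_cut g Pg; rewrite parabolicE.
Qed.

(** Gaussian elimination inside [P], [k] being the number of columns that
remain to be cleared: an entry to be cleared is nonzero, so no stable cut
separates its row from its column, and the row operation belongs to [P]. *)
Lemma has_matrix_elim k (M : 'M[F]_N) : (k <= N)%N -> M \in unitmx ->
  block_triangular stable_cut M ->
  (forall i j : 'I_N, (j < i)%N -> (j + k < N)%N -> M i j = 0) -> Q M.
Proof.
elim: k M => [|k IHk] M kN uM btM H.
  by apply: has_matrix_upper => // i j ij; apply: H; rewrite // addn0.
have aN : (N - k.+1 < N)%N by rewrite subnSK // leq_subr.
pose a : 'I_N := Ordinal aN.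
have Na : (a + k.+1)%N = N by rewrite /= subnK.
have Ha : forall i j : 'I_N, (j < i)%N -> (j < a)%N -> M i j = 0.
  by move=> i j ji ja; apply: H => //; rewrite -[X in (_ < X)%N]Na ltn_add2r.
(* the case of a nonzero diagonal entry, to which a row addition reduces *)
have clear (M' : 'M[F]_N) : M' \in unitmx -> block_triangular stable_cut M' ->
    (forall i j : 'I_N, (j < i)%N -> (j < a)%N -> M' i j = 0) ->
    M' a a != 0 -> Q M'.
  move=> {H Ha btM} {}uM btM H Maa.
  pose v : 'cV[F]_N := \col_i (if (a < i)%N then - (M' i a / M' a a) else 0).
  have va : v a 0 = 0 by rewrite mxE ltnn.
  have Qv : Q (transv v (row_delta a)).
    apply: has_matrix_transv_sum => // i; rewrite mxE; case: ifP => [ai|]; last by rewrite eqxx.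
    rewrite oppr_eq0 mulf_eq0 invr_eq0 (negbTE Maa) orbF => Mia.
    apply: root_lower => //; apply: contra Mia => cut.
    by move: btM => /forallP/(_ i)/forallP/(_ a)/implyP/(_ cut).
  apply: (has_matrixVr Qv); apply: IHk; first exact: ltnW.
  - by rewrite unitmx_mul (has_matrix_unit Qv).
  - by apply: block_triangularM => //; apply: has_matrix_block_triangular.
  move=> i j ji; rewrite -[X in (_ < X)%N]Na addnS ltnS leq_add2r.
  rewrite leq_eqVlt transv_deltaM => /orP[/eqP/val_inj ja|ja].
    by rewrite ja mxE -ja ji ja mulNr mulfVK // subrr.
  by rewrite !H ?mulr0 ?addr0.
have [i ai Mia] := pivot_exists uM Ha.
case: (eqVneq (M a a) 0) => [Maa|]; last exact: clear.
have {}ai : (a < i)%N.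
  by rewrite ltn_neqAle ai andbT; apply: contraNneq Mia => /val_inj <-; rewrite Maa.
have Qr := root_upper ai 1.
apply: (has_matrixVr Qr); apply: clear.
- by rewrite unitmx_mul (has_matrix_unit Qr).
- by apply: block_triangularM => //; apply: has_matrix_block_triangular.
- move=> k' j jk ja; rewrite transv_deltaM !Ha ?mulr0 ?addr0 //.
  exact: ltn_trans ja ai.
by rewrite transv_deltaM Maa add0r !mxE !eqxx !mul1r.
Qed.

(** An overgroup of the Borel subgroup is the stabilizer of the flag formed by
the coordinate subspaces that it preserves. *)
Lemma overgroup_borelE : P :=: parabolic stable_cut.
Proof.
apply/eqP; rewrite eqEsubset sub_parabolic_stable_cut /=.
apply/subsetP => g; rewrite parabolicE => btg.
have [] := @has_matrix_elim N (GLval g) (leqnn _) (GL_unitmx g) btg.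
  by move=> i j _; rewrite ltnNge leq_addl.
by move=> h Ph /val_inj <-.
Qed.

End Overgroup.
End Parabolic.

(** * Orders of block triangular groups *)

Section Cardinals.
Variables (F : finFieldType).
Implicit Type S : pred nat.
Local Notation q := #|F|.

(** The elements of a parabolic group as matrices of arbitrary size [k],
including 0, so that blocks can be split off by induction. *)
Definition block_units S k : {set 'M[F]_k} :=
  [set M : 'M[F]_k | (M \in unitmx) && block_triangular S M].

Lemma card_parabolic n S : #|parabolic F n S| = #|block_units S n.-1.+1|.
Proof.
have injGL : injective (@GLval n F) by exact: val_inj.
rewrite -(card_imset (mem (parabolic F n S)) injGL); congr #|pred_of_set _|.
apply/setP => M; rewrite inE; apply/imsetP/andP => [[g gP ->]|[uM btM]].
  by split; [exact: GL_unitmx | rewrite -parabolicE].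
by exists (Sub M uM : {'GL_n[F]}); rewrite ?parabolicE.
Qed.

Lemma eq_block_units S S' k : (forall c, 0 < c -> S c = S' c) ->
  block_units S k = block_units S' k.
Proof.
move=> eqS; apply/setP => M; rewrite !inE; congr (_ && _).
apply/block_triangularP/block_triangularP => H i j c cji Sc;
  have c0 : 0 < c by (case/andP: cji => + _; apply: leq_ltn_trans).
- by apply: (H i j c cji); rewrite eqS.
- by apply: (H i j c cji); rewrite -eqS.
Qed.

Lemma block_units_block S k r (A : 'M[F]_k) (B : 'M_(k, r)) (D : 'M_r) :
    (forall c, 0 < c < k -> ~~ S c) ->
  block_mx A B 0%R D \in block_units S (k + r) =
  (A \in unitmx) && (D \in block_units (fun c => S (k + c)) r).
Proof.
move=> noS; rewrite !inE !unitmxE det_ublock unitrM -andbA; do 2!congr (_ && _).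
apply/block_triangularP/block_triangularP => H i j c /andP[jc ci] Sc.
  rewrite -(block_mxEdr A B 0%R D).
  by apply: (H _ _ (k + c)) => //=; rewrite ltn_add2l leq_add2l jc.
case: (split_ordP i) ci => i' ->; case: (split_ordP j) jc => j' -> /= jc ci.
- suff /noS : 0 < c < k by rewrite Sc.
  by rewrite (leq_ltn_trans _ jc) //= (leq_ltn_trans ci).
- by move: (ltn_ord i'); rewrite ltnNge (leq_trans _ ci) // (leq_trans _ (ltnW jc)) // leq_addr.
- by rewrite block_mxEdl mxE.
rewrite block_mxEdr.
have kc : k <= c by rewrite (leq_trans _ (ltnW jc)) // leq_addr.
apply: (H i' j' (c - k)); last by rewrite subnKC.
by rewrite ltn_subRL jc leq_subLR ci.
Qed.

Lemma card_block_units S k r :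
    (forall c, 0 < c < k -> ~~ S c) -> (0 < r -> S k) ->
  #|block_units S (k + r)| =
    #|[set A : 'M[F]_k | A \in unitmx]| * q ^ (k * r) *
    #|block_units (fun c => S (k + c)) r|.
Proof.
move=> noS Sk.
pose f (x : 'M[F]_k * 'M[F]_(k, r) * 'M[F]_r) := block_mx x.1.1 x.1.2 0%R x.2.
have injf : injective f.
  by move=> [[A B] D] [[A' B'] D'] /eq_block_mx /= [-> -> _ ->].
pose X := setX (setX [set A : 'M[F]_k | A \in unitmx] [set: 'M[F]_(k, r)])
               (block_units (fun c => S (k + c)) r).
transitivity #|f @: X|; last by rewrite card_imset // !cardsX cardsT card_mx.
congr #|pred_of_set _|; apply/setP => M; apply/idP/imsetP => [Mb|[[[A B] D]]]; last first.
  rewrite !in_setX /= in_setT andbT => xX ->.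
  by rewrite block_units_block // -[_ \in unitmx]in_set.
have dl0 : dlsubmx M = 0%R.
  apply/matrixP => i j; rewrite !mxE.
  move: Mb; rewrite inE => /andP[_ /block_triangularP]; apply=> /=; last first.
    by apply: Sk; apply: leq_ltn_trans (ltn_ord i).
  by rewrite /= ltn_ord leq_addr.
exists (ulsubmx M, ursubmx M, drsubmx M); last by rewrite /f /= -dl0 submxK.
move: Mb; rewrite -{1}[M]submxK dl0 block_units_block // => Mb.
by rewrite !in_setX in_setT andbT /= in_set.
Qed.

Lemma block_units_gt0 S k : 0 < #|block_units S k|.
Proof.
apply/card_gt0P; exists 1%:M%R.
by rewrite inE unitmx1 block_triangular1.
Qed.

Fixpoint is_partial_sum (s : seq nat) (c : nat) : bool :=
  if s is k :: s' then (c == k) || (k <= c) && is_partial_sum s' (c - k) else false.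

Variable l : nat.
Hypotheses (l_pr : prime l) (lq : coprime l q).

Lemma logn_prod_nat k (G : nat -> nat) : (forall i, 0 < i -> 0 < G i) ->
  logn l (\prod_(1 <= i < k.+1) G i) = \sum_(1 <= i < k.+1) logn l (G i).
Proof.
move=> G0; elim: k => [|k IHk]; first by rewrite !big_geq ?logn1.
rewrite [in LHS]big_nat_recr // [in RHS]big_nat_recr //=.
rewrite lognM ?IHk ?G0 // big_seq prodn_cond_gt0 // => i.
by rewrite mem_index_iota => /andP[i0 _]; apply: G0.
Qed.

Definition logn_GL k := logn l #|[set A : 'M[F]_k | A \in unitmx]|.

(** The unipotent radical has order a power of [q], invisible to [l]. *)
Lemma logn_card_block_units S k r :
    (forall c, 0 < c < k -> ~~ S c) -> (0 < r -> S k) ->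
  logn l #|block_units S (k + r)| =
    logn_GL k + logn l #|block_units (fun c => S (k + c)) r|.
Proof.
move=> noS Sk; rewrite card_block_units //.
have q0 : 0 < q ^ (k * r) by rewrite expn_gt0; apply/orP; left; apply/card_gt0P; exists 0%R.
have u0 : 0 < #|[set A : 'M[F]_k | A \in unitmx]|.
  by apply/card_gt0P; exists 1%:M%R; rewrite inE unitmx1.
rewrite !lognM ?muln_gt0 ?q0 ?u0 ?block_units_gt0 //.
by rewrite [logn l (q ^ _)]logn_coprime ?addn0 // coprimeXr.
Qed.

Lemma logn_block_units0 S : logn l #|block_units S 0| = 0.
Proof.
rewrite (_ : block_units S 0 = [set 1%:M%R]) ?cards1 ?logn1 //.
apply/setP => M; have -> : M = (1%:M)%R by rewrite [LHS]flatmx0 [RHS]flatmx0.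
by rewrite !inE eqxx unitmxE det_mx00 unitr1; apply/block_triangularP => [[]].
Qed.

Lemma logn_block_units_partial_sums s : all (leq 1) s ->
  logn l #|block_units (is_partial_sum s) (sumn s)| = \sum_(k <- s) logn_GL k.
Proof.
elim: s => [|k s IHs] /=; first by rewrite big_nil logn_block_units0.
case/andP => k0 s0; rewrite big_cons logn_card_block_units /=; last 2 first.
- by move=> c /andP[c0 ck]; rewrite negb_or neq_ltn ck /= leqNgt ck.
- by rewrite eqxx.
congr (_ + _); rewrite -IHs //; congr (logn l #|pred_of_set _|).
apply: eq_block_units => c c0; rewrite leq_addr addKn.
by rewrite -[X in _ == X]addn0 eqn_add2l eqn0Ngt c0.
Qed.

Lemma logn_block_units S n : exists s,
  [/\ all (leq 1) s, sumn s = n & logn l #|block_units S n| = \sum_(k <- s) logn_GL k].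
Proof.
elim/ltn_ind: n S => -[|n] IHn S.
  by exists [::]; rewrite big_nil logn_block_units0.
have exk : exists k, [&& 0 < k, k <= n.+1 & S k || (k == n.+1)].
  by exists n.+1; rewrite leqnn eqxx orbT.
have [k /and3P[k0 kn Sk] kmin] := ex_minnP exk.
have [|s [s0 ss es]] := IHn (n.+1 - k) _ (fun c => S (k + c)).
  by rewrite ltn_subLR // -[X in X < _]add0n ltn_add2r.
exists (k :: s); rewrite /= k0 ss subnKC // big_cons -es; split=> //.
rewrite -[in LHS](subnKC kn) logn_card_block_units // => [c /andP[c0 ck]|].
  apply/negP => Sc; have := kmin c; rewrite c0 Sc (leq_trans (ltnW ck)) //=.
  by move=> /(_ isT); rewrite leqNgt ck.
by rewrite subn_gt0 => kn1; move: Sk; rewrite (ltn_eqF kn1) orbF.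
Qed.

Lemma logn_block_units_predT n : logn l #|block_units predT n| = n * logn_GL 1.
Proof.
elim: n => [|n IHn]; first by rewrite logn_block_units0.
rewrite -add1n logn_card_block_units // ?mulnDl ?mul1n -?IHn //.
by case=> [|[]].
Qed.

Lemma qnumE q i : 1 < q -> q ^ i - 1 = (q - 1) * qnum q i.
Proof. by move=> q1; rewrite /qnum mulnC divnK // !subn1 dvdn_pred_predX. Qed.

(** The [l]-adic valuation of the [q]-factorial of [k]. *)
Definition vqfact k := \sum_(1 <= i < k.+1) logn l (qnum q i).

Lemma logn_GLE k : 0 < k -> logn_GL k = k * logn l (q - 1) + vqfact k.
Proof.
move=> k0; have q1 := card_finRing_gt1 F.
have qX i : 0 < i -> 0 < q ^ i - 1.
  by move=> i0; rewrite subn_gt0 -[X in X < _](expn0 q) ltn_exp2l.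
rewrite /logn_GL (_ : #|_| = #|'GL_k[F]%g|); last first.
  by case: k k0 => // k _; rewrite /= cardsT card_sub; apply: eq_card => A; rewrite inE.
rewrite card_GL // lognM ?expn_gt0 ?(ltnW q1) //; last first.
  rewrite big_seq prodn_cond_gt0 // => i.
  by rewrite mem_index_iota => /andP[i0 _]; apply: qX.
rewrite (logn_coprime (coprimeXr _ lq)) add0n.
rewrite -[X in X * logn _ _]subn0 -subSS -sum_nat_const_nat -big_split /=.
rewrite logn_prod_nat //; apply: eq_big_nat => i /andP[i0 _].
have := qX i i0; rewrite qnumE // muln_gt0 => /andP[q10 qi0].
by rewrite lognM.
Qed.

Lemma vqfact1 : vqfact 1 = 0.
Proof. by rewrite /vqfact big_nat1 /qnum expn1 divnn subn_gt0 card_finRing_gt1 logn1. Qed.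

Lemma sum_logn_GL s : all (leq 1) s ->
  \sum_(k <- s) logn_GL k = sumn s * logn l (q - 1) + \sum_(k <- s) vqfact k.
Proof.
elim: s => [|k s IHs] /=; first by rewrite !big_nil.
by case/andP => k0 /IHs IH; rewrite !big_cons IH logn_GLE // mulnDl addnACA.
Qed.

Variable n : nat.
Hypothesis n0 : 0 < n.

Lemma phi_block_units (P : {group {'GL_n[F]}}) S : P :=: parabolic F n S ->
  logn l #|block_units S n| = n * logn l (q - 1) + phi l P.
Proof.
move=> PS; have BP : borel n F \subset P by rewrite PS borel_sub_parabolic.
have nE : n.-1.+1 = n by rewrite prednK.
have := LagrangeI P (borel_group n F); rewrite (setIidPr BP) /phi => oP.
have cP : #|P| = #|block_units S n| by rewrite PS card_parabolic nE.
have cB : #|borel n F| = #|block_units predT n|.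
  by rewrite borel_parabolic card_parabolic nE.
rewrite -cP -oP lognM ?indexg_gt0 ?(cardG_gt0 (borel_group n F)) //.
by rewrite cB logn_block_units_predT logn_GLE // vqfact1 addn0 mul1n.
Qed.

Lemma phi_composition (P : {group {'GL_n[F]}}) : borel n F \subset P ->
  exists s, [/\ all (leq 1) s, sumn s = n & phi l P = \sum_(k <- s) vqfact k].
Proof.
move=> BP; have [s [s0 ss es]] := logn_block_units (stable_cut P) n.
exists s; split=> //; apply/eqP; rewrite -(eqn_add2l (n * logn l (q - 1))).
by rewrite -(phi_block_units (overgroup_borelE BP)) es sum_logn_GL // ss.
Qed.

Lemma composition_phi s : all (leq 1) s -> sumn s = n ->
  phi l (parabolic_group F n (is_partial_sum s)) = \sum_(k <- s) vqfact k.
Proof.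
move=> s0 ss; apply/eqP; rewrite -(eqn_add2l (n * logn l (q - 1))).
rewrite -(phi_block_units (erefl _)).
by have := logn_block_units_partial_sums s0; rewrite ss sum_logn_GL // ss => ->.
Qed.

Lemma index_phi (P : {group {'GL_n[F]}}) : borel n F \subset P ->
  logn l #|'GL_n[F] : P|%g + phi l P = logn l #|'GL_n[F] : borel n F|%g.
Proof.
move=> BP; rewrite /phi -lognM ?indexg_gt0 //.
by rewrite (Lagrange_index (subsetT _) BP).
Qed.
End Cardinals.

(** * Valuations of q-integers and factorials *)

(** The [q]-integer of [i]; unlike [qnum], it obeys the identities below for every
base, in particular for the powers of [q]. *)
Definition geom q i := \sum_(j < i) q ^ j.

Lemma geomS q i : geom q i.+1 = geom q i + q ^ i.
Proof. by rewrite /geom big_ord_recr. Qed.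

Lemma geom0 q : geom q 0 = 0.
Proof. by rewrite /geom big_ord0. Qed.

Lemma geom_gt0 q i : 0 < i -> 0 < geom q i.
Proof. by case: i => // i _; rewrite /geom big_ord_recl. Qed.

Lemma geomD q a b : geom q (a + b) = geom q a + q ^ a * geom q b.
Proof.
elim: b => [|b IHb]; first by rewrite geom0 muln0 !addn0.
by rewrite addnS !geomS IHb mulnDr expnD addnA.
Qed.

Lemma geomM q a b : geom q (a * b) = geom q a * geom (q ^ a) b.
Proof.
elim: b => [|b IHb]; first by rewrite muln0 !geom0 muln0.
by rewrite mulnS addnC geomD geomS IHb -expnM mulnDr (mulnC (geom q a) (q ^ _)).
Qed.

Lemma exp_pred_geom q i : 0 < q -> q ^ i = (q - 1) * geom q i + 1.
Proof. by move=> q0; rewrite subn1 -predn_exp addn1 prednK // expn_gt0 q0. Qed.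

Lemma qnum_geom q i : 1 < q -> qnum q i = geom q i.
Proof.
move=> q1; rewrite /qnum (exp_pred_geom i (ltnW q1)) addnK mulKn //.
by rewrite subn_gt0.
Qed.

Section Valuation.
Variable l : nat.
Hypothesis l_pr : prime l.

Lemma expn_mod_square u k : exists t, (1 + l * u) ^ k = 1 + k * (l * u) + l ^ 2 * t.
Proof.
elim: k => [|k [t IHk]]; first by exists 0; rewrite expn0 muln0.
by exists (t + k * u ^ 2 + l * t * u); rewrite expnS IHk; ring.
Qed.

(** Working modulo [l ^ 2] decides the exact power of [l] in [geom q l]. *)
Lemma geom_mod_square u k :
  exists t, geom (1 + l * u) k = k + l * u * 'C(k, 2) + l ^ 2 * t.
Proof.
elim: k => [|k [t IHk]]; first by exists 0; rewrite geom0 bin0n !muln0.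
have [t' et'] := expn_mod_square u k.
by exists (t + t'); rewrite geomS IHk et' binS bin1; ring.
Qed.

Lemma logn_geom_prime u : (l = 2 -> 2 %| u) -> logn l (geom (1 + l * u) l) = 1.
Proof.
move=> u2; have l0 := prime_gt0 l_pr; have [t ->] := geom_mod_square u l.
have [v ->] : exists v, l * u * 'C(l, 2) = l ^ 2 * v.
  case: (eqVneq l 2) => [l2|l_neq2].
    by move: (u2 l2) => /dvdnP[w ->]; rewrite l2; exists w; rewrite binn; ring.
  have /dvdnP[w ->] : l %| 'C(l, 2).
    by apply: prime_dvd_bin => //=; have := prime_gt1 l_pr; lia.
  by exists (u * w); ring.
have -> : l + l ^ 2 * v + l ^ 2 * t = l * (1 + l * (v + t)) by ring.
rewrite lognM // logn_prime // eqxx logn_coprime ?addn0 //.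
by rewrite prime_coprime // dvdn_addl ?dvdn_mulr // dvdn1; have := prime_gt1 l_pr; lia.
Qed.

Lemma geom_mod u k : geom (1 + l * u) k = k %[mod l].
Proof.
have [t ->] := geom_mod_square u k.
have -> : k + l * u * 'C(k, 2) + l ^ 2 * t = (u * 'C(k, 2) + l * t) * l + k by ring.
exact: modnMDl.
Qed.

(** Lifting the exponent. A factor [l] of [j] is split off by [geomM], which
replaces the base by its [l]-th power, again congruent to 1 modulo [l]. For
[l = 2] the base must be 1 modulo 4: the valuation of [geom 3 2 = 4] is 2. *)
Lemma logn_geom u j : (l = 2 -> 2 %| u) -> 0 < j ->
  logn l (geom (1 + l * u) j) = logn l j.
Proof.
elim/ltn_ind: j u => j IHj u u2 j0; case: (boolP (l %| j)) => [/dvdnP[i ij]|lj].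
  have i0 : 0 < i by move: j0; rewrite ij; case: i {ij}.
  have ij_lt : i < j by rewrite ij ltn_Pmulr ?prime_gt1.
  have [t et] := expn_mod_square u l.
  have eX : (1 + l * u) ^ l = 1 + l * (l * (u + t)) by rewrite et; ring.
  rewrite ij (mulnC i) geomM lognM ?geom_gt0 ?(prime_gt0 l_pr) // logn_geom_prime //.
  rewrite eX IHj // ?lognM ?(prime_gt0 l_pr) // ?(logn_prime l l_pr) ?eqxx //.
  by move=> l2; rewrite l2 dvdn_mulr.
by rewrite !logn_coprime // prime_coprime // /dvdn ?geom_mod.
Qed.

Section MinimalExponent.
Variables q e : nat.
Hypotheses (q_gt1 : 1 < q) (lq : coprime l q) (e_min : is_min (e_cond l q) e).

Lemma min_exp_gt1 : 1 < e. Proof. by case: e_min => /andP[]. Qed.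

Lemma dvdn_geom_min : l %| geom q e.
Proof. by case: e_min => /andP[_]; rewrite qnum_geom. Qed.

(** Writing [i = e a + r], [l] divides [geom q r] with [r < e], and minimality
of [e] leaves only [r = 0], since [geom q 1 = 1]. *)
Lemma dvdn_qnum i : (l %| geom q i) = (e %| i).
Proof.
have e1 := min_exp_gt1.
have le a : l %| geom q (e * a) by rewrite geomM dvdn_mulr ?dvdn_geom_min.
have lqX a : coprime l (q ^ a) by rewrite coprimeXr.
apply/idP/dvdnP => [|[a ->]]; last by rewrite mulnC.
rewrite {1}(divn_eq i e) mulnC geomD dvdn_addr // Gauss_dvdr // => lr.
have re : i %% e < e by rewrite ltn_mod ltnW.
exists (i %/ e); rewrite {1}(divn_eq i e).
case: (i %% e) lr re => [|[|r]] lr re; first by rewrite addn0.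
  by move: lr; rewrite geomS geom0 expn0 dvdn1; have := prime_gt1 l_pr; lia.
case: e_min => _ /(_ r.+2); rewrite /e_cond qnum_geom // lr => /(_ isT).
by rewrite leqNgt re.
Qed.

(** For [l = 2] the base [q] is odd, which supplies the second factor 2. *)
Lemma expn_min_exp : exists2 u, q ^ e = 1 + l * u & (l = 2 -> 2 %| u).
Proof.
have /dvdnP[w ew] := dvdn_geom_min.
exists ((q - 1) * w); first by rewrite exp_pred_geom ?(ltnW q_gt1) // ew; ring.
move=> l2; apply: dvdn_mulr; rewrite dvdn2 oddB ?(ltnW q_gt1) //.
by move: lq; rewrite l2 coprime2n => ->.
Qed.

Lemma logn_qnum i : 0 < i ->
  logn l (qnum q i) = if e %| i then logn l (qnum q e) + logn l (i %/ e) else 0.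
Proof.
move=> i0; rewrite !qnum_geom //; have e0 : 0 < e by rewrite ltnW ?min_exp_gt1.
case: ifP => [/dvdnP[j ej]|/negbT ei]; last first.
  by rewrite logn_coprime // prime_coprime // dvdn_qnum.
have j0 : 0 < j by move: i0; rewrite ej; case: j {ej}.
have [u eu u2] := expn_min_exp.
by rewrite ej mulnK // (mulnC j) geomM lognM ?geom_gt0 // eu logn_geom.
Qed.

Lemma logn_qnum_min_gt0 : 0 < logn l (qnum q e).
Proof.
by rewrite logn_gt0 mem_primes l_pr qnum_geom // geom_gt0 ?dvdn_geom_min // ltnW ?min_exp_gt1.
Qed.

End MinimalExponent.

Definition vfact k := logn l k`!.

(** Used both for [G i] the valuation of [qnum q i] and, with [e = l] and
[d = 1], for [G = logn l], where it is the recursion of Legendre. *)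
Lemma sum_logn_multiples (G : nat -> nat) e d k : 0 < e ->
    (forall i, 0 < i -> G i = if e %| i then d + logn l (i %/ e) else 0) ->
  \sum_(1 <= i < k.+1) G i = d * (k %/ e) + vfact (k %/ e).
Proof.
move=> e0 GE; elim: k => [|k IHk]; first by rewrite big_geq // div0n muln0 /vfact logn1.
rewrite big_nat_recr //= IHk GE // divnS //.
case: (e %| k.+1); last by rewrite add0n addn0.
rewrite !add1n /vfact factS lognM ?fact_gt0 // mulnS.
by rewrite addnACA (addnC d) (addnC (logn _ _)).
Qed.

Lemma vfactE k : vfact k = k %/ l + vfact (k %/ l).
Proof.
have l0 := prime_gt0 l_pr.
transitivity (\sum_(1 <= i < k.+1) logn l i); last first.
  rewrite (@sum_logn_multiples _ l 1) ?mul1n // => i i0.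
  case: ifP => [/dvdnP[j ej]|/negbT li]; last by rewrite logn_coprime // prime_coprime.
  have j0 : 0 < j by move: i0; rewrite ej; case: j {ej}.
  by rewrite ej mulnK // mulnC lognM // logn_prime // eqxx.
elim: k => [|k IHk]; first by rewrite big_geq // /vfact logn1.
by rewrite big_nat_recr //= -IHk /vfact factS lognM ?fact_gt0 // addnC.
Qed.

Lemma vfactMD a r : r < l -> vfact (l * a + r) = a + vfact a.
Proof.
by move=> rl; rewrite vfactE mulnC divnMDl ?(prime_gt0 l_pr) // (divn_small rl) addn0.
Qed.

Lemma vfact_small r : r < l -> vfact r = 0.
Proof. by move=> rl; have := vfactMD 0 rl; rewrite muln0 => ->; rewrite /vfact logn1. Qed.

Lemma vfact_digits m (x : nat -> nat) : (forall i, i <= m -> x i < l) ->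
  vfact (\sum_(0 <= i < m.+1) x i * l ^ i) = \sum_(0 <= i < m.+1) x i * geom l i.
Proof.
elim: m x => [|m IHm] x xl; first by rewrite !big_nat1 geom0 muln1 muln0 vfact_small ?xl.
have IH := IHm (fun i => x i.+1) (fun i im => xl i.+1 im).
rewrite big_nat_recl // muln1 addnC.
rewrite (_ : \sum_(0 <= i < m.+1) _ = l * \sum_(0 <= i < m.+1) x i.+1 * l ^ i); last first.
  by rewrite big_distrr; apply: eq_bigr => i _; rewrite expnS mulnCA.
rewrite vfactMD ?xl // IH [RHS]big_nat_recl // geom0 muln0 add0n -big_split.
by apply: eq_bigr => i _; rewrite geomS mulnDr addnC.
Qed.

Lemma vfactD a b : vfact a + vfact b <= vfact (a + b).
Proof.
rewrite /vfact -lognM ?fact_gt0 // dvdn_leq_log ?fact_gt0 //.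
by apply/dvdnP; exists 'C(a + b, a); rewrite -(@bin_fact (a + b) a) ?leq_addr // addKn.
Qed.

Lemma vfact_homo a b : a <= b -> vfact a <= vfact b.
Proof. by move/subnKC <-; apply: leq_trans (vfactD _ _); apply: leq_addr. Qed.

Lemma vfact_sum s : \sum_(k <- s) vfact k <= vfact (sumn s).
Proof.
elim: s => [|k s IHs]; first by rewrite big_nil.
by rewrite big_cons /=; apply: leq_trans (vfactD _ _); rewrite leq_add2l.
Qed.

Lemma sum_vfact_nseq1 r : \sum_(k <- nseq r 1) vfact k = 0.
Proof. by rewrite big1_seq // => k /andP[_ /nseqP[-> _]]; rewrite vfact_small ?prime_gt1. Qed.

(** Parts 1 contribute nothing and a part [l] contributes 1, which handles
[t <= s %/ l]. Beyond that, a composition of [s %/ l] with value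
[t - s %/ l] is scaled by [l]: by [vfactE] this adds [s %/ l]. *)
Lemma vfact_composition s t : t <= vfact s ->
  exists r, [/\ all (leq 1) r, sumn r = s & \sum_(k <- r) vfact k = t].
Proof.
have l0 := prime_gt0 l_pr; have l1 := prime_gt1 l_pr.
elim/ltn_ind: s t => s IHs t; rewrite vfactE => ts.
have ones r : all (leq 1) (nseq r 1) by rewrite all_nseq orbT.
case: (leqP t (s %/ l)) => [tl|lt].
  have tls : l * t <= s by rewrite mulnC -leq_divRL.
  exists (nseq t l ++ nseq (s - l * t) 1).
  rewrite all_cat ones all_nseq l0 orbT sumn_cat !sumn_nseq mul1n subnKC //.
  rewrite big_cat /= sum_vfact_nseq1 addn0 big_nseq iter_addn_0.
  by have := vfactMD 1 l0; rewrite muln1 addn0 (vfact_small l1) => ->; rewrite mul1n.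
have s0 : 0 < s by case: s ts lt {IHs} => //; rewrite div0n /vfact logn1; lia.
have [|r [r0 rs rt]] := IHs (s %/ l) (ltn_Pdiv l1 s0) (t - s %/ l).
  by rewrite leq_subLR.
exists (map (muln l) r ++ nseq (s %% l) 1); rewrite all_cat ones andbT; split.
- by rewrite all_map; apply: sub_all r0 => k k0 /=; rewrite muln_gt0 l0.
- rewrite sumn_cat sumn_nseq mul1n {2}(divn_eq s l) -rs; congr (_ + _).
  by rewrite mulnC !sumnE big_map big_distrr.
rewrite big_cat /= sum_vfact_nseq1 addn0 big_map.
under eq_bigr => k _ do rewrite -[l * k]addn0 (vfactMD k l0).
by rewrite big_split /= rt -sumnE rs subnKC // ltnW.
Qed.

(** The integers that lie in one of the intervals
[[d * s, d * s + vfact s]] with [s <= N]. *)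
Definition spread d N v := has (fun s => d * s <= v <= d * s + vfact s) (iota 0 N.+1).

Lemma spreadP d N v :
  reflect (exists s t, [/\ s <= N, t <= vfact s & v = d * s + t]) (spread d N v).
Proof.
apply: (iffP hasP) => [[s sN /andP[sv vs]]|[s [t [sN ts ->]]]].
  exists s, (v - d * s); rewrite leq_subLR vs subnKC //.
  by move: sN; rewrite mem_iota add0n ltnS.
by exists s; rewrite ?mem_iota ?add0n ?ltnS // leq_addr leq_add2l.
Qed.

Lemma sum_divn_leq e s : 0 < e -> sumn [seq k %/ e | k <- s] <= sumn s %/ e.
Proof.
move=> e0; elim: s => [|k s IHs] //=.
rewrite leq_divRL // mulnDl leq_add ?leq_trunc_div //.
by apply: leq_trans (leq_trunc_div _ e); rewrite leq_mul2r IHs orbT.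
Qed.

(** In [G k = d * (k %/ e) + vfact (k %/ e)] a composition of [n] only matters
through the quotients [k %/ e], whose sum is at most [n %/ e]. Any sequence
with such a sum is attained: its entries are multiplied by [e] and completed
by parts 1, whose quotient is 0 because [1 < e]. *)
Lemma spread_compositions (G : nat -> nat) e d n v : 1 < e ->
    (forall k, G k = d * (k %/ e) + vfact (k %/ e)) ->
  spread d (n %/ e) v <->
  exists r, [/\ all (leq 1) r, sumn r = n & v = \sum_(k <- r) G k].
Proof.
move=> e1 GE; have e0 := ltnW e1; split=> [/spreadP[s [t [sN ts ->]]]|[r [r0 <- ->]]].
  have [r [r0 rs rt]] := vfact_composition ts.
  have esn : e * s <= n by rewrite mulnC -leq_divRL.
  exists (map (muln e) r ++ nseq (n - e * s) 1); split.
  - rewrite all_cat all_nseq orbT andbT all_map.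
    by apply: sub_all r0 => k k0 /=; rewrite muln_gt0 e0.
  - rewrite sumn_cat sumn_nseq mul1n sumnE big_map -big_distrr /= -sumnE rs.
    exact: subnKC.
  have G1 : G 1 = 0 by rewrite GE divn_small // muln0 /vfact logn1.
  rewrite big_cat /= big_map big_nseq G1 iter_addn_0 mul0n addn0.
  under eq_bigr => k _ do rewrite GE mulKn //.
  by rewrite big_split /= rt -big_distrr /= -sumnE rs.
apply/spreadP; exists (sumn [seq k %/ e | k <- r]), (\sum_(k <- [seq k %/ e | k <- r]) vfact k).
rewrite sum_divn_leq // vfact_sum; split=> //.
rewrite sumnE !big_map big_distrr -big_split /=.
by apply: eq_bigr => k _; rewrite GE.
Qed.

Section Count.
Variables d N : nat.
Hypothesis d0 : 0 < d.

Definition nspread b := count (spread d N) (iota 0 b).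

Lemma nspreadD a b : nspread (a + b) = nspread a + count (spread d N) (iota a b).
Proof. by rewrite /nspread iotaD count_cat add0n. Qed.

Lemma nspread_full a b : (forall v, a <= v < a + b -> spread d N v) ->
  nspread (a + b) = nspread a + b.
Proof.
move=> H; rewrite nspreadD; congr (_ + _); apply/eqP.
rewrite -[X in _ == X](size_iota a) -all_count; apply/allP => v.
by rewrite mem_iota; apply: H.
Qed.

Lemma nspread_leq a : nspread a <= a.
Proof. by rewrite -[X in _ <= X](size_iota 0) count_size. Qed.

Lemma spread_mid s v : s <= N -> d * s <= v <= d * s + vfact s -> spread d N v.
Proof.
move=> sN /andP[sv vs]; apply/spreadP; exists s, (v - d * s).
by rewrite leq_subLR vs subnKC.
Qed.

Lemma spread_max v : spread d N v -> v <= d * N + vfact N.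
Proof.
case/spreadP => s [t [sN ts ->]]; rewrite leq_add // ?leq_mul //.
by apply: leq_trans ts _; apply: vfact_homo.
Qed.

Lemma nspread_top : nspread (d * N + (vfact N).+1) = nspread (d * N) + (vfact N).+1.
Proof.
by apply: nspread_full => v; rewrite addnS ltnS; apply: spread_mid.
Qed.

(** The interval that starts at [d * s] has [vfact s + 1] elements, of which
those in the window [[d * s, d * s.+1[] are counted. *)
Lemma nspread_step s c : s < N -> 0 < c <= d -> c <= (vfact s).+1 ->
  nspread (d * s) + c <= nspread (d * s.+1).
Proof.
move=> sN /andP[c0 cd] cs; rewrite -nspread_full => [|v /andP[sv vs]].
  have -> : d * s.+1 = d * s + c + (d - c) by rewrite mulnS; lia.
  by rewrite [X in _ <= X]nspreadD leq_addr.
by apply: (@spread_mid s); [exact: ltnW | rewrite sv; lia].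
Qed.

Lemma nspread_lower s : s <= N -> s <= nspread (d * s).
Proof.
elim: s => [//|s IHs] sN; apply: leq_trans (nspread_step (c := 1) sN _ _) => //.
by rewrite addn1 ltnS IHs // ltnW.
Qed.

Section Large.
Hypothesis dlN : d * l <= N.

(** From [s = d * l] on the intervals leave no gap, since then
[vfact s >= s %/ l >= d]. *)
Lemma nspread_large : nspread (d * N + (vfact N).+1) =
  nspread (d ^ 2 * l) + (d * N + (vfact N).+1 - d ^ 2 * l).
Proof.
have dlN2 : d ^ 2 * l <= d * N by rewrite -mulnn -mulnA leq_mul.
rewrite -[in LHS](@subnKC (d ^ 2 * l) (d * N + _)); last by lia.
apply: nspread_full => v /andP[av vb].
have vb' : v < d * N + (vfact N).+1 by lia.
case: (leqP (d * N) v) => [Nv|vN].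
  by apply: (@spread_mid N) => //; rewrite Nv -ltnS -addnS.
have sN : v %/ d < N by rewrite ltn_divLR // mulnC.
have vE := divn_eq v d; have rd : v %% d < d by rewrite ltn_mod.
apply: (@spread_mid (v %/ d)); first exact: ltnW.
have ls : d <= (v %/ d) %/ l.
  rewrite leq_divRL ?(prime_gt0 l_pr) // leq_divRL //.
  by apply: leq_trans av; rewrite -mulnn mulnAC.
have lv := vfactE (v %/ d).
by move: (v %/ d) (v %% d) vE rd ls lv => a b; rewrite (mulnC d); lia.
Qed.

Lemma sum_quotients a : \sum_(0 <= s < a * l) (s %/ l).+1 = l * 'C(a.+1, 2).
Proof.
elim: a => [|a IHa]; first by rewrite mul0n big_geq // muln0.
rewrite mulSn addnC (@big_cat_nat _ _ _ (a * l)) ?leq_addr //= IHa.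
have l0 := prime_gt0 l_pr.
rewrite (eq_big_nat _ _ (F2 := fun=> a.+1)) => [|i /andP[ai ia]].
  by rewrite sum_nat_const_nat addKn [in RHS]binS bin1; ring.
congr _.+1; apply/eqP; rewrite eqn_leq -ltnS ltn_divLR // leq_divRL //.
by rewrite ai mulSn addnC ia.
Qed.

(** Each window with [s < d * l] contains at least [s %/ l + 1 <= d] values. *)
Lemma nspread_low : l * 'C(d.+1, 2) <= nspread (d ^ 2 * l).
Proof.
rewrite -sum_quotients.
have -> : d ^ 2 * l = d * (d * l) by ring.
suff H s : s <= d * l -> \sum_(0 <= i < s) (i %/ l).+1 <= nspread (d * s) by apply: H.
elim: s => [|s IHs] sd; first by rewrite big_geq.
rewrite big_nat_recr //=; apply: leq_trans (nspread_step (c := (s %/ l).+1) _ _ _).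
- by rewrite leq_add2r IHs // ltnW.
- exact: leq_trans sd dlN.
- by rewrite /= ltn_divLR // prime_gt0.
by rewrite ltnS vfactE leq_addr.
Qed.

(** For [s < d * l <= l ^ 2] the valuation [vfact s] is exactly [s %/ l < d], so
the intervals are disjoint and stay inside their windows. *)
Lemma nspread_low_eq : d <= l -> nspread (d ^ 2 * l) = l * 'C(d.+1, 2).
Proof.
move=> dl; apply/eqP; rewrite eqn_leq nspread_low andbT -sum_quotients.
have -> : d ^ 2 * l = d * (d * l) by ring.
suff H s : s <= d * l -> nspread (d * s) <= \sum_(0 <= i < s) (i %/ l).+1 by apply: H.
elim: s => [|s IHs] sd; first by rewrite muln0.
rewrite big_nat_recr //= mulnS (addnC d) nspreadD; apply: leq_add; first by rewrite IHs // ltnW.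
have sl : s %/ l < d by rewrite ltn_divLR // prime_gt0.
rewrite -[X in iota _ X](subnKC sl) iotaD count_cat.
rewrite [X in _ + X](_ : _ = 0) ?addn0.
  by apply: (leq_trans (count_size _ _)); rewrite size_iota.
apply/eqP; rewrite -leqn0 leqNgt -has_count; apply/hasPn => v.
rewrite mem_iota -addnA subnKC // => /andP[vs vd].
apply/negP => /spreadP[s' [t [s'N ts' ev]]].
have s's : s' <= s by rewrite -ltnS -(ltn_pmul2l d0); lia.
have s'l : s' %/ l <= s %/ l by apply: leq_div2r.
have ts'' : t <= s' %/ l.
  by apply: leq_trans ts' _; rewrite vfactE (vfact_small (r := _ %/ _)) ?addn0; lia.
have := leq_mul (leqnn d) s's; lia.
Qed.

End Large.
End Count.
End Valuation.

(** * The values of phi *)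

Lemma coprime_card_finField (F : finFieldType) p l :
  p \in [pchar F]%R -> prime l -> l != p -> coprime l #|F|.
Proof.
move=> charF l_pr lp; have p_pr : prime p by case/andP: charF.
rewrite (card_pprimeChar charF) coprimeXr // prime_coprime //.
by rewrite dvdn_prime2.
Qed.

Lemma size_undup_count (t : seq nat) (P : pred nat) b :
  (forall v, (v \in t) = (v < b) && P v) -> size (undup t) = count P (iota 0 b).
Proof.
move=> tE; rewrite -size_filter; apply: perm_size; apply: uniq_perm.
- exact: undup_uniq.
- by rewrite filter_uniq ?iota_uniq.
by move=> v; rewrite mem_undup tE mem_filter mem_iota add0n andbC.
Qed.

(** Used with the valuations of [#|GL_n : P|] and [#|P : B|], which add up to that
of [#|GL_n : B|]. *)
Lemma size_undup_complement (T : eqType) (f g : T -> nat) h (s : seq T) :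
  (forall x, x \in s -> f x + g x = h) ->
  size (undup (map f s)) = size (undup (map g s)).
Proof.
elim: s => //= a s IHs H.
have Hs x : x \in s -> f x + g x = h by move=> xs; apply: H; rewrite inE xs orbT.
have Ha := H a (mem_head a s).
have -> : (f a \in map f s) = (g a \in map g s).
  by apply/mapP/mapP => [[x xs E]|[x xs E]]; exists x => //; have := Hs x xs; lia.
by case: ifP => _ /=; rewrite IHs.
Qed.

Section Values.
Variables (n : nat) (F : finFieldType) (l e : nat).
Hypotheses (n_gt0 : 0 < n) (l_pr : prime l) (lq : coprime l #|F|).
Hypothesis e_min : is_min (e_cond l #|F|) e.
Local Notation q := #|F|.
Local Notation d := (logn l (qnum q e)).

Lemma vqfactE k : vqfact F l k = d * (k %/ e) + vfact l (k %/ e).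
Proof.
have e0 : 0 < e := ltnW (min_exp_gt1 e_min).
apply: (sum_logn_multiples (G := fun i => logn l (qnum q i)) k e0) => i i0.
exact: (logn_qnum l_pr (card_finRing_gt1 F) lq e_min i0).
Qed.

Lemma phi_spread v :
  reflect (exists2 P : {group {'GL_n[F]}}, P \in std_parabolics n F & v = phi l P)
          (spread l d (n %/ e) v).
Proof.
have spreadE w := spread_compositions l_pr n w (min_exp_gt1 e_min) vqfactE.
apply: (iffP idP) => [/spreadE[s [s0 ss ->]]|[P]].
  exists (parabolic_group F n (is_partial_sum s)); last by rewrite composition_phi.
  by rewrite inE borel_sub_parabolic.
rewrite inE => BP ->; apply/spreadE.
have [s [s0 ss es]] := phi_composition lq n_gt0 BP.
by exists s.
Qed.

Lemma num_phi_belowE b : num_phi_below n F l b = nspread l d (n %/ e) b.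
Proof.
apply: size_undup_count => v; apply/imageP/andP => [[P]|[vb /phi_spread[P stdP vP]]].
  rewrite inE => /andP[stdP Pb] ->; split=> //.
  by apply/phi_spread; exists P.
by exists P; rewrite // inE stdP -vP.
Qed.

Lemma num_PvaluesE :
  num_Pvalues n F l = nspread l d (n %/ e) (d * (n %/ e) + (vfact l (n %/ e)).+1).
Proof.
rewrite /num_Pvalues (@size_undup_complement _ _ (@phi n F l)
  (logn l #|'GL_n[F] : borel n F|%g)) => [|P].
  apply: size_undup_count => v; rewrite addnS ltnS.
  apply/imageP/andP => [[P stdP ->]|[_ /phi_spread[P stdP ->]]]; last by exists P.
  have vP : spread l d (n %/ e) (phi l P) by apply/phi_spread; exists P.
  by split=> //; apply: spread_max vP.
by rewrite mem_enum inE => /index_phi.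
Qed.

End Values.

Lemma bin2_double k : 'C(k.+1, 2) * 2 = k.+1 * k.
Proof. by elim: k => // k IHk; rewrite binS bin1 mulnDl IHk; lia. Qed.

Theorem theorem6p3 (n : nat) (F : finFieldType) (p l e d m : nat) (x : nat -> nat)
  (n_ge2 : 2 <= n)
  (charF : p \in [pchar F]%R)
  (l_prime : prime l)
  (l_neq_p : l != p)
  (e_def : is_min (e_cond l #|F|) e)
  (d_def : d = logn l (qnum #|F| e))
  (m_def : m = trunc_log l (n %/ e))
  (x_digit : forall i, i <= m -> x i < l)
  (x_expansion : n %/ e = \sum_(0 <= i < m.+1) x i * l ^ i) :
  let V := num_Pvalues n F l in
  let A := sumA l m x in
  let Z := sumZ l d m x in
  let C := sumC l m x in
  let X := num_phi_below n F l (d * (n %/ e)) in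
  let Y := num_phi_below n F l (d ^ 2 * l) in
  [/\ V = C + X, n %/ e <= X & A <= V <= Z] /\
  (d * l <= n %/ e ->
   [/\ (V%:Z = Z%:Z - (d ^ 2 * l)%N%:Z + Y%:Z)%R,
       (l * d * (d + 1)) %/ 2 <= Y,
       (Z%:Z - ((l * d * (d - 1)) %/ 2)%N%:Z <= V%:Z)%R /\ V <= Z
     & d <= l ->
       Y = (l * d * (d + 1)) %/ 2 /\
       (V%:Z = Z%:Z - ((l * d * (d - 1)) %/ 2)%N%:Z)%R]).
Proof.
move=> V A Z C X Y; set N := n %/ e in x_expansion X *.
have lq := coprime_card_finField charF l_prime l_neq_p.
have d_gt0 : 0 < d by rewrite d_def (logn_qnum_min_gt0 l_prime (card_finRing_gt1 F) e_def).
have XE : X = nspread l d N (d * N) by rewrite /X (num_phi_belowE (e := e)) -?d_def // ltnW.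
have YE : Y = nspread l d N (d ^ 2 * l) by rewrite /Y (num_phi_belowE (e := e)) -?d_def // ltnW.
have VE : V = nspread l d N (d * N + (vfact l N).+1).
  by rewrite /V (num_PvaluesE (e := e)) -?d_def // ltnW.
have tauN : vfact l N = \sum_(0 <= i < m.+1) x i * geom l i.
  by rewrite x_expansion (vfact_digits l_prime).
have CE : C = (vfact l N).+1.
  by rewrite /C /sumC tauN [in RHS]big_ltn // geom0 muln0 add0n addn1.
have ZE : Z = d * N + (vfact l N).+1.
  rewrite /Z /sumZ addn1 addnS tauN x_expansion big_distrr -big_split /=.
  by congr _.+1; apply: eq_bigr => i _; rewrite mulnDr mulnCA.
have AE : A = N + (vfact l N).+1.
  rewrite /A /sumA add1n addnS tauN x_expansion -big_split /=.
  by congr _.+1; apply: eq_bigr => i _; rewrite -mulnDr big_ord_recr addnC.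
have VCX : V = C + X by rewrite VE CE XE nspread_top // addnC.
have NX : N <= X by rewrite XE nspread_lower.
have VZ : V <= Z by rewrite VE ZE nspread_leq.
split; first by split=> //; rewrite VZ andbT AE VCX CE; lia.
move=> dlN; have VY : V + d ^ 2 * l = Z + Y.
  have dlN2 : d ^ 2 * l <= d * N by rewrite -mulnn -mulnA leq_mul.
  by rewrite VE ZE YE (nspread_large l_prime d_gt0 dlN); lia.
have [d' dE] : exists d', d = d'.+1 by exists d.-1; rewrite prednK.
(* d ^ 2 is the sum of two consecutive triangular numbers *)
pose T := l * 'C(d.+1, 2); pose T' := l * 'C(d, 2).
have TE : (l * d * (d + 1)) %/ 2 = T.
  have -> : l * d * (d + 1) = T * 2 by rewrite /T -[RHS]mulnA bin2_double addn1; ring.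
  by rewrite mulnK.
have TE' : (l * d * (d - 1)) %/ 2 = T'.
  have -> : l * d * (d - 1) = T' * 2.
    by rewrite /T' -[RHS]mulnA dE bin2_double subn1 /=; ring.
  by rewrite mulnK.
have TT : d ^ 2 * l = T + T'.
  apply/eqP; rewrite -(eqn_pmul2r (isT : 0 < 2)) mulnDl -TE -TE'.
  by apply/eqP; rewrite TE TE' /T /T' -!mulnA bin2_double dE bin2_double; ring.
have TY : T <= Y by rewrite YE nspread_low.
rewrite TE TE'; split=> //; [lia | lia | move=> dl].
have YT : Y = T by rewrite YE nspread_low_eq.
by split=> //; lia.
Qed.
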